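(* Let $G$ be a compact group, $H$ an irreducible unitary $G$-module of real type, $J:H\to H$ a conjugation with $J^2=1$, and $(h_k)_{-\ell\le k\le\ell}$ an orthonormal basis of $H$ that is self-conjugated with respect to $J$. Let $D_{ij}(g)=\langle gh_j,h_i\rangle$. Let $0\le s\le \ell$ and $0<m\le\ell$ be indices of basis elements and let $g\in G$. Then $$|D_{s,m}(g)|=|D_{s,-m}(g)|$$ if and only if $$\langle g(h_m\wedge h_{-m}),\,h_s\wedge h_{-s}\rangle_2=0 .$$
   Context: A conjugation of a (complex) $G$-module $H$ is an antilinear map $J:H\to H$ commuting with the action of $G$. $H$ is of real type if it admits a conjugation with $J^2=1$. $\langle\cdot,\cdot\rangle$ denotes the $G$-invariant scalar product on $H$. The basis $(h_k)_{-\ell\le k\le\ell}$ is self-conjugated with respect to $J$ if $h_{-k}=J(h_k)$ for every $k$; if $\dim H$ is even the index $k=0$ is omitted (and $\dim H=2\ell$), while if $\dim H$ is odd $\dim H=2\ell+1$. $\bigwedge^2H$ carries the $G$-action $g(v\wedge w)=gv\wedge gw$ and the $G$-invariant scalar product determined by $$\langle v_1\wedge w_1,v_2\wedge w_2\rangle_2=\langle v_1,v_2\rangle\langle w_1,w_2\rangle-\langle v_1,w_2\rangle\langle w_1,v_2\rangle .$$ *)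

(* Defs.v *)
From HB Require Import structures.
From mathcomp Require Import all_boot all_order all_algebra.
From mathcomp Require Import all_classical all_reals all_analysis.
From mathcomp Require Import complex ring.

Set Implicit Arguments.
Unset Strict Implicit.
Unset Printing Implicit Defensive.

Import Order.TTheory GRing.Theory Num.Theory Num.Def.

Local Open Scope classical_set_scope.
Local Open Scope complex_scope.
Local Open Scope ring_scope.

HB.mixin Record Topological_isTopologicalGroup G
    of Group G & Topological G := {
  mulg_continuous : continuous (fun x : G * G => (x.1 * x.2)%g) ;
  invg_continuous : continuous (fun x : G => (x^-1)%g)
}.

#[short(type="topologicalGroupType")]
HB.structure Definition TopologicalGroup :=
  {G of Group G & Topological G & Topological_isTopologicalGroup G}.

Definition compact_group (G : topologicalGroupType) : Prop :=
  compact [set: G].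

(* The scalar product is linear in its first argument and antilinear in its
   second one. *)
Record unitaryModule (R : realType) (G : topologicalGroupType) :=
  UnitaryModule {
    module_space :> vectType R[i] ;
    mdot : {dot module_space for conjC} ;
    mact : G -> 'End(module_space) ;
    mact1 : mact 1%g = \1%VF ;
    mactM : forall g k, mact (g * k)%g = (mact g \o mact k)%VF ;
    mact_unitary : forall g u v, mdot (mact g u) (mact g v) = mdot u v ;
    mact_continuous : forall v g0 (e : R), 0 < e ->
      \forall g \near g0,
        sqrtC (mdot (mact g v - mact g0 v) (mact g v - mact g0 v)) < e%:C
  }.

Section UnitaryModule.
Variables (R : realType) (G : topologicalGroupType) (H : unitaryModule R G).

Definition irreducible : Prop :=
  ({:H} != 0)%VS /\
  forall U : {vspace H}, (forall g, mact H g @: U <= U)%VS ->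
    U = 0%VS \/ U = fullv.

Definition conjugation (J : {linear H -> H | conjC \; *:%R}) : Prop :=
  forall g v, J (mact H g v) = mact H g (J v).

Definition real_type : Prop :=
  exists J : {linear H -> H | conjC \; *:%R}, conjugation J /\ involutive J.

(* The indices -l, ..., l in increasing order, without 0 if dim H is even. *)
Definition basis_indices (l : nat) : seq int :=
  [seq k <- [seq i%:Z - l%:Z | i <- iota 0 l.*2.+1]
         | odd (\dim {:H}) || (k != 0)].

(* Only the values of h on basis_indices l matter. *)
Definition orthonormal_basis (l : nat) (h : int -> H) : Prop :=
  orthonormal (mdot H) (map h (basis_indices l)) /\
  basis_of fullv (map h (basis_indices l)).

Definition self_conjugated (J : H -> H) (l : nat) (h : int -> H) : Prop :=
  forall k, k \in basis_indices l -> h (- k) = J (h k).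

Definition matrix_coef (h : int -> H) (i j : int) (g : G) : R[i] :=
  mdot H (mact H g (h j)) (h i).

End UnitaryModule.

(* The exterior square is characterized by its universal property, its action
   and scalar product by their values on decomposable vectors. The lemmas
   exteriorSquare_exists, ext2_action_exists and ext2_dot_exists (the last one
   from an orthonormal basis as in the statement) show that such
   objects always exist. *)
Record exteriorSquare (F : fieldType) (V : vectType F) := ExteriorSquare {
  ext2_space :> vectType F ;
  wedge : {bilinear V -> V -> ext2_space} ;
  wedge_alt : forall v, wedge v v = 0 ;
  wedge_universal : forall (W : vectType F) (f : {bilinear V -> V -> W}),
    (forall v, f v v = 0) ->
    exists! phi : 'Hom(ext2_space, W), forall v w, phi (wedge v w) = f v w
}.

Section ExteriorSquareModule.
Variables (R : realType) (G : topologicalGroupType) (H : unitaryModule R G).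
Variable (E : exteriorSquare H).

Definition ext2_action (act2 : G -> 'End(E)) : Prop :=
  forall g v w, act2 g (wedge E v w) = wedge E (mact H g v) (mact H g w).

Definition ext2_dot (dot2 : {dot E for conjC}) : Prop :=
  forall v1 w1 v2 w2,
    dot2 (wedge E v1 w1) (wedge E v2 w2) =
    mdot H v1 v2 * mdot H w1 w2 - mdot H v1 w2 * mdot H w1 v2.

End ExteriorSquareModule.

Section ExteriorSquareExistence.
Variables (F : numFieldType) (V : vectType F) (n : nat) (b : n.-tuple V).
Hypothesis b_basis : basis_of fullv b.

Definition wedge_mx (v w : V) : 'M[F]_n :=
  \matrix_(i, j) (coord b i v * coord b j w - coord b j v * coord b i w).

Fact wedge_mx_bilinear : bilinear_for *:%R *:%R wedge_mx.
Proof.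
split=> u a x y; apply/matrixP=> i j; rewrite !mxE !linearP /=; ring.
Qed.

HB.instance Definition _ :=
  bilinear_isBilinear.Build F V V 'M[F]_n *:%R *:%R wedge_mx wedge_mx_bilinear.

Fact wedge_mx_alt v : wedge_mx v v = 0.
Proof. by apply/matrixP=> i j; rewrite !mxE mulrC subrr. Qed.

Fact bilinear_coord (W : vectType F) (f : {bilinear V -> V -> W}) v w :
  f v w = \sum_i \sum_j (coord b i v * coord b j w) *: f b`_i b`_j.
Proof.
have E x : x = \sum_i coord b i x *: b`_i by apply/coord_basis/memvf.
rewrite {1}(E v) linear_sumlz; apply: eq_bigr => i _.
rewrite {1}(E w) linear_sumr; apply: eq_bigr => j _.
by rewrite linearZl_LR linearZr_LR scalerA.
Qed.

Definition mx_contract (W : vectType F) (f : V -> V -> W) (A : 'M[F]_n) : W :=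
  2^-1 *: \sum_i \sum_j A i j *: f b`_i b`_j.

Fact mx_contract_linear (W : vectType F) (f : V -> V -> W) :
  linear (mx_contract f).
Proof.
move=> a A B; rewrite /mx_contract scalerA mulrC -scalerA -scalerDr.
congr (_ *: _); rewrite scaler_sumr -big_split; apply: eq_bigr => i _ /=.
rewrite scaler_sumr -big_split; apply: eq_bigr => j _ /=.
by rewrite !mxE scalerDl scalerA.
Qed.

HB.instance Definition _ (W : vectType F) (f : V -> V -> W) :=
  GRing.isLinear.Build F 'M[F]_n W *:%R (mx_contract f)
    (mx_contract_linear f).

Fact alt_anti (W : vectType F) (f : {bilinear V -> V -> W}) :
  (forall v, f v v = 0) -> forall v w, f w v = - f v w.
Proof.
move=> f0 v w; apply/eqP; rewrite -addr_eq0; apply/eqP.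
by have := f0 (v + w); rewrite linearDl /= !linearDr /= !f0 add0r addr0 addrC.
Qed.

Fact mx_contract_wedge (W : vectType F) (f : {bilinear V -> V -> W}) :
  (forall v, f v v = 0) -> forall v w, mx_contract f (wedge_mx v w) = f v w.
Proof.
move=> f0 v w; rewrite /mx_contract.
under eq_bigr do under eq_bigr do rewrite mxE scalerBl.
under eq_bigr do rewrite sumrB.
rewrite sumrB -bilinear_coord.
under [X in _ - X]eq_bigr do
  under eq_bigr do rewrite mulrC (alt_anti f0) scalerN -[_ * _]mulrC.
rewrite exchange_big /=.
under [X in _ - X]eq_bigr do rewrite sumrN.
rewrite sumrN opprK -bilinear_coord -mulr2n -scaler_nat scalerA.
by rewrite mulVf ?pnatr_eq0 // scale1r.
Qed.

(* The antisymmetric matrices, a concrete model of the exterior square. *)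
Definition anti_mx : {vspace 'M[F]_n} := limg (linfun (mx_contract wedge_mx)).

Fact wedge_mx_in v w : wedge_mx v w \in anti_mx.
Proof.
apply/memv_imgP; exists (wedge_mx v w); first exact: memvf.
by rewrite lfunE /= mx_contract_wedge //; exact: wedge_mx_alt.
Qed.

Definition anti_wedge (v w : V) : subvs_of anti_mx :=
  vsproj anti_mx (wedge_mx v w).

Fact anti_wedge_bilinear : bilinear_for *:%R *:%R anti_wedge.
Proof.
by split=> u a x y; rewrite /anti_wedge ?linearPl ?linearPr /= linearP.
Qed.

HB.instance Definition _ :=
  bilinear_isBilinear.Build F V V (subvs_of anti_mx) *:%R *:%R anti_wedge
    anti_wedge_bilinear.

Fact anti_wedge_alt v : anti_wedge v v = 0.
Proof. by rewrite /anti_wedge wedge_mx_alt linear0. Qed.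

Fact anti_wedge_universal (W : vectType F) (f : {bilinear V -> V -> W}) :
  (forall v, f v v = 0) ->
  exists! phi : 'Hom(subvs_of anti_mx, W),
    forall v w, phi (anti_wedge v w) = f v w.
Proof.
move=> f0; exists (linfun (mx_contract f) \o linfun vsval)%VF; split.
  move=> v w; rewrite !lfunE /= !lfunE /= vsprojK ?wedge_mx_in //.
  exact: mx_contract_wedge.
move=> psi psiE; apply/lfunP=> x.
have /memv_imgP[A _ xE] := subvsP x.
rewrite lfunE /= /mx_contract in xE.
have {xE} -> : x = 2^-1 *: \sum_i \sum_j A i j *: anti_wedge b`_i b`_j.
  rewrite -[LHS]vsvalK xE linearZ; congr (_ *: _).
  rewrite linear_sum; apply: eq_bigr => i _.
  by rewrite linear_sum; apply: eq_bigr => j _; rewrite linearZ.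
have homE (k : 'Hom(subvs_of anti_mx, W)) :
    k (2^-1 *: \sum_i \sum_j A i j *: anti_wedge b`_i b`_j) =
    2^-1 *: \sum_i \sum_j A i j *: k (anti_wedge b`_i b`_j).
  rewrite linearZ linear_sum; congr (_ *: _); apply: eq_bigr => i _.
  by rewrite linear_sum; apply: eq_bigr => j _; rewrite linearZ.
rewrite !homE; congr (_ *: _); apply: eq_bigr => i _; apply: eq_bigr => j _.
rewrite psiE lfunE /= !lfunE /= vsprojK ?wedge_mx_in //.
by rewrite mx_contract_wedge.
Qed.

End ExteriorSquareExistence.

Lemma exteriorSquare_exists (F : numFieldType) (V : vectType F) :
  inhabited (exteriorSquare V).
Proof.
exists; apply: (@ExteriorSquare _ _ (subvs_of (anti_mx (vbasis {:V})))
  (anti_wedge (vbasis {:V}))) => [v|W f f0].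
  exact: anti_wedge_alt.
exact: (anti_wedge_universal (vbasisP _) f0).
Qed.

Section ExteriorSquareModuleExistence.
Variables (R : realType) (G : topologicalGroupType) (H : unitaryModule R G).
Variable (E : exteriorSquare H).

Lemma ext2_action_exists : exists act2, @ext2_action _ _ _ E act2.
Proof.
suff /choice[act2 act2P] : forall g, exists phi : 'End(E), forall v w,
    phi (wedge E v w) = wedge E (mact H g v) (mact H g w) by exists act2.
move=> g; pose f v w := wedge E (mact H g v) (mact H g w).
have fB : bilinear_for *:%R *:%R f.
  by split=> u a x y; rewrite /f linearP ?linearPl ?linearPr.
pose fI := bilinear_isBilinear.Build _ H H E *:%R *:%R f fB.
pose ff : {bilinear H -> H -> E} := HB.pack f fI.
have [phi [phiE _]] := @wedge_universal _ _ E _ ff (fun=> wedge_alt _ _).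
by exists phi.
Qed.

Lemma wedge_mx_dot n (b : n.-tuple H) v1 w1 v2 w2 :
  orthonormal (mdot H) b -> basis_of fullv b ->
  2^-1 * \sum_i \sum_j wedge_mx b v1 w1 i j * (wedge_mx b v2 w2 i j)^* =
  mdot H v1 v2 * mdot H w1 w2 - mdot H v1 w2 * mdot H w1 v2.
Proof.
move=> bO bB.
have dotE x y : mdot H x y = \sum_i coord b i x * (coord b i y)^*.
  rewrite {1}(coord_basis bB (memvf x)) linear_sumlz; apply: eq_bigr => i _.
  rewrite {1}(coord_basis bB (memvf y)) linear_sumr (bigD1 i) //=.
  rewrite big1 ?addr0 => [|j ji].
    rewrite linearZl_LR linearZr_LR /=.
    have /orthonormalP[_ ->] := bO; rewrite ?mem_nth ?size_tuple //.
    by rewrite eqxx mulr1.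
  rewrite linearZl_LR linearZr_LR /=.
  have /orthonormalP[bU ->] := bO; rewrite ?mem_nth ?size_tuple //.
  by rewrite nth_uniq ?size_tuple // val_eqE eq_sym (negPf ji) !mulr0.
have sumM (x y z t : H) : mdot H x y * mdot H z t =
    \sum_i \sum_j (coord b i x * (coord b i y)^*) *
                   (coord b j z * (coord b j t)^*).
  by rewrite !dotE mulr_suml; apply: eq_bigr => i _; rewrite mulr_sumr.
have two : (2 : R[i]) != 0 by rewrite pnatr_eq0.
apply: (mulfI two); rewrite mulrA divff // mul1r mulrBr.
rewrite mulr_natl mulr2n mulr_natl mulr2n.
rewrite {2}[mdot H v1 v2 * _]mulrC {2}[mdot H v1 w2 * _]mulrC !sumM.
rewrite -!big_split -sumrB; apply: eq_bigr => i _ /=.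
rewrite -!big_split -sumrB; apply: eq_bigr => j _ /=.
rewrite !mxE rmorphB !rmorphM /=; ring.
Qed.

Lemma ext2_dot_exists l (h : int -> H) :
  orthonormal_basis l h -> exists dot2 : {dot E for conjC}, ext2_dot dot2.
Proof.
set b := in_tuple (map h (basis_indices H l)) => -[bO bB].
have [M [ME _]] := wedge_universal E (wedge_mx_alt b).
pose dot2 x y := 2^-1 * \sum_i \sum_j M x i j * (M y i j)^*.
have dot2B : bilinear_for *%R (conjC \; *%R) dot2.
  split=> u a x y; rewrite /dot2 /= mulrCA -mulrDr; congr (_ * _);
    rewrite mulr_sumr -big_split; apply: eq_bigr => i _ /=;
    rewrite mulr_sumr -big_split; apply: eq_bigr => j _ /=;
    rewrite linearP !mxE ?rmorphD ?rmorphM /=; ring.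
have dot2H x y : dot2 x y = (-1) ^+ false * (dot2 y x)^*.
  rewrite mul1r /dot2 rmorphM fmorphV rmorph_nat rmorph_sum; congr (_ * _).
  apply: eq_bigr => i _; rewrite rmorph_sum; apply: eq_bigr => j _.
  by rewrite rmorphM /= conjCK mulrC.
have M_inj x : M x = 0 -> x = 0.
  have [id2 [_ id2U]] := wedge_universal E (@wedge_alt _ _ E).
  pose L := (linfun (mx_contract b (wedge E)) \o M)%VF.
  have L1 : L = \1%VF.
    rewrite -(id2U L) -1?(id2U \1%VF) // => v w; rewrite lfunE //=.
    by rewrite lfunE /= ME mx_contract_wedge //; exact: wedge_alt.
  move=> Mx0; have := congr1 (fun k : 'End(E) => k x) L1.
  by rewrite !lfunE /= Mx0 linear0 => <-.
have dot2P x : x != 0 -> 0 < dot2 x x.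
  move=> x0; rewrite /dot2 mulr_gt0 ?invr_gt0 ?ltr0n // lt_def.
  have ge0 i j : 0 <= M x i j * (M x i j)^* by exact: mul_conjC_ge0.
  rewrite sumr_ge0 ?andbT => [|i _]; last by rewrite sumr_ge0.
  apply: contra x0 => /eqP S0; apply/eqP/M_inj/matrixP=> i j.
  have /(_ i isT)Si := psumr_eq0P (fun i _ => sumr_ge0 _ (fun j _ => ge0 i j)) S0.
  have /(_ j isT)/eqP := psumr_eq0P (fun j _ => ge0 i j) Si.
  by rewrite mul_conjC_eq0 mxE => /eqP.
pose I1 := bilinear_isBilinear.Build _ E E R[i] *%R (conjC \; *%R) dot2 dot2B.
pose I2 := isHermitianSesquilinear.Build _ E false conjC dot2 dot2H.
pose I3 := isDotProduct.Build _ E dot2 dot2P.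
pose d : {dot E for conjC} := HB.pack dot2 I1 I2 I3.
exists d => v1 w1 v2 w2; rewrite -(@wedge_mx_dot _ b) //=.
by rewrite /dot2 !ME.
Qed.

End ExteriorSquareModuleExistence.

(* Main.v *)
Require Import Defs.
From mathcomp Require Import all_boot all_order all_algebra.
From mathcomp Require Import all_classical all_reals all_analysis.
From mathcomp Require Import complex.
Import Order.TTheory GRing.Theory Num.Theory Num.Def.
Local Open Scope ring_scope.

(** Since the basis is orthonormal and self-conjugated, J permutes it (by
    k |-> - k), hence J is antiunitary: the scalar product of J u and J v is the
    conjugate of that of u and v (antiunitary_self_conjugated).  As J commutes
    with the action of G, replacing both indices of a matrix coefficient by
    their opposites conjugates it (matrix_coef_opp).  The scalar product of
    g (h_m /\ h_-m) with h_s /\ h_-s is a 2 x 2 minor of the matrix of g,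
    namely D_(s,m) D_(-s,-m) - D_(-s,m) D_(s,-m), and by this symmetry it equals
    |D_(s,m)|^2 - |D_(s,-m)|^2, which vanishes exactly when the two moduli
    agree. *)

(** Both sides are linear in v and antilinear in u, so the identity only has to
    be tested on a basis. *)
Lemma antilinear_dot_conj {R : realType} {V : vectType R[i]}
    (dot : {dot V for conjC}) (J : {linear V -> V | conjC \; *:%R})
    (n : nat) (b : n.-tuple V) :
  basis_of fullv b ->
  (forall i j : 'I_n, dot (J b`_i) (J b`_j) = (dot b`_i b`_j)^*) ->
  forall u v, dot (J u) (J v) = (dot u v)^*.
Proof.
move=> bB Jb u v.
rewrite (coord_basis bB (memvf u)) (coord_basis bB (memvf v)) !(linear_sum J).
rewrite !(linear_sumlz dot) rmorph_sum; apply: eq_bigr => i _.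
rewrite !(linear_sumr dot) rmorph_sum; apply: eq_bigr => j _.
rewrite !linearZ_LR /= !linearZl_LR !linearZr_LR /= Jb.
by rewrite !rmorphM.
Qed.

Section SelfConjugatedBasis.
Context {R : realType} {G : topologicalGroupType} {H : unitaryModule R G}.
Context {J : {linear H -> H | conjC \; *:%R}} {l : nat} {h : int -> H}.

Lemma oppr_basis_indices (k : int) :
  (- k \in basis_indices H l) = (k \in basis_indices H l).
Proof.
suff sub (j : int) : j \in basis_indices H l -> - j \in basis_indices H l.
  by apply/idP/idP => /sub //; rewrite opprK.
rewrite !mem_filter oppr_eq0 => /andP[-> /mapP[n]].
rewrite mem_iota add0n andTb => nl ->.
apply/mapP; exists (l.*2 - n)%N; first by rewrite mem_iota ltnS leq_subr.
by rewrite -subzn // -addnn PoszD opprB addrAC addrK.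
Qed.

Lemma dot_orthonormal_basis : orthonormal_basis l h ->
  {in basis_indices H l &, forall j k, mdot H (h j) (h k) = (j == k)%:R}.
Proof.
move=> [/orthonormalP[hU hO] _] j k jI kI; rewrite hO ?map_f //.
have h_inj : h j = h k -> j = k.
  move=> hjk; rewrite -(nth_index 0 jI) -(nth_index 0 kI); congr nth.
  apply/eqP; rewrite -(nth_uniq 0 _ _ hU) ?size_map ?index_mem //.
  by rewrite !(nth_map 0) ?index_mem // !nth_index // hjk.
by congr ((nat_of_bool _)%:R); apply/eqP/eqP => [/h_inj|->].
Qed.

(** J permutes an orthonormal basis; its scalar products are 0 or 1, hence
    invariant under conjugation. *)
Lemma antiunitary_self_conjugated :
  orthonormal_basis l h -> self_conjugated J l h ->
  forall u v, mdot H (J u) (J v) = (mdot H u v)^*.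
Proof.
move=> hON hJ; have [_ hB] := hON.
apply: (@antilinear_dot_conj _ _ _ _ _ (in_tuple (map h (basis_indices H l)))).
  exact: hB.
move=> i j /=; have [iI jI] : (i < size (basis_indices H l))%N
    /\ (j < size (basis_indices H l))%N.
  by split; rewrite -(size_map h) ltn_ord.
rewrite !(nth_map 0) // -!hJ ?mem_nth // !dot_orthonormal_basis //;
  rewrite ?oppr_basis_indices ?mem_nth //.
by rewrite eqr_opp rmorph_nat.
Qed.

Lemma matrix_coef_opp {j k : int} (g : G) :
  conjugation J -> orthonormal_basis l h -> self_conjugated J l h ->
  j \in basis_indices H l -> k \in basis_indices H l ->
  matrix_coef h (- j) (- k) g = (matrix_coef h j k g)^*.
Proof.
move=> JG hON hJ jI kI.
by rewrite /matrix_coef !hJ // -JG antiunitary_self_conjugated.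
Qed.

End SelfConjugatedBasis.

Theorem proposition5p3 (R : realType) (G : topologicalGroupType)
    (H : unitaryModule R G) (J : {linear H -> H | conjC \; *:%R})
    (l : nat) (h : int -> H)
    (E : exteriorSquare H) (act2 : G -> 'End(E)) (dot2 : {dot E for conjC})
    (s m : int) (g : G) :
  compact_group G ->
  irreducible H ->
  real_type H ->
  conjugation J ->
  (forall v, J (J v) = v) ->
  orthonormal_basis l h ->
  self_conjugated J l h ->
  ext2_action act2 ->
  ext2_dot dot2 ->
  s \in basis_indices H l -> 0 <= s <= l%:Z ->
  m \in basis_indices H l -> 0 < m <= l%:Z ->
  `|matrix_coef h s m g| = `|matrix_coef h s (- m) g| <->
  dot2 (act2 g (wedge E (h m) (h (- m)))) (wedge E (h s) (h (- s))) = 0.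
Proof.
move=> _ _ _ JG _ hON hJ act2E dot2E sI _ mI _.
have mnI : - m \in basis_indices H l by rewrite oppr_basis_indices.
have Dm := matrix_coef_opp g JG hON hJ sI mI.
have Dmn := matrix_coef_opp g JG hON hJ sI mnI.
rewrite opprK in Dmn.
have DE : dot2 (act2 g (wedge E (h m) (h (- m)))) (wedge E (h s) (h (- s))) =
    `|matrix_coef h s m g| ^+ 2 - `|matrix_coef h s (- m) g| ^+ 2.
  rewrite act2E dot2E -!/(matrix_coef h _ _ g) Dm Dmn.
  by rewrite [X in _ - X]mulrC !normCK.
rewrite DE; split=> [->|/eqP]; first by rewrite subrr.
by rewrite subr_eq0 eqrXn2 // => /eqP.
Qed.
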